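(* Let $n$ and $k$ be integers with $1\le k<n/2$, let $\Pi$ be a simple allowable sequence on $[n]$ and let $\pi=(\pi_0,\pi_1,\dots,\pi_{\binom n2})$ be any halfperiod of $\Pi$. If $s=s(k,\pi)$, then $$E_{\ge k}(\Pi)\le (n-2k-1)\,E_{k-1}(\Pi)-\frac{s}{2}\bigl(E_{k-1}(\Pi)-n+1\bigr).$$
   Context: Write $[n]=\{1,2,\dots,n\}$. A simple allowable sequence on $[n]$ is a doubly infinite sequence $\Pi=(\dots,\pi_{-1},\pi_0,\pi_1,\dots)$ of permutations of $[n]$ such that any two consecutive permutations $\pi_i,\pi_{i+1}$ differ by a transposition of two elements in adjacent positions, and such that for every $j$ the permutation $\pi_j$ is the reverse of $\pi_{j+\binom n2}$. A halfperiod of $\Pi$ is a sequence of $\binom n2+1$ consecutive permutations of $\Pi$; it is (re)indexed as $\pi=(\pi_0,\pi_1,\dots,\pi_{\binom n2})$. (In a halfperiod every pair of elements of $[n]$ is transposed exactly once.) A transposition of the elements in positions $j$ and $j+1$ is called a $j$-transposition. For an integer $1\le j\le n/2$, a transposition is $j$-critical if it is a $j$-transposition or an $(n-j)$-transposition. For integers $0\le j\le n/2-1$, $E_j(\Pi)$ denotes the number of $(j+1)$-critical transpositions in a halfperiod of $\Pi$ (this number does not depend on the halfperiod), and $E_{\ge k}(\Pi)=\sum_{j=k}^{\lfloor n/2\rfloor-1}E_j(\Pi)$. The $k$-center $C(k,\pi_j)$ of the permutation $\pi_j$ is the set of elements occupying the middle $n-2k$ positions of $\pi_j$ (positions $k+1,\dots,n-k$).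 Put $C_0=C(k,\pi_0)$ and $$s(k,\pi)=\min\Bigl\{|C_0\cap C(k,\pi_i)| : 0\le i\le \tbinom n2\Bigr\}.$$ *)

(* Defs.v *)
From mathcomp Require Import all_boot all_order all_fingroup all_algebra.

Set Implicit Arguments.
Unset Strict Implicit.
Unset Printing Implicit Defensive.

Import GRing.Theory.
Local Open Scope ring_scope.

(* The set [n] and the positions 1, ..., n are both represented by 'I_n,
   shifted by one: for a permutation s : 'S_n, the element s p occupies the
   position p + 1.  The indices j of j-transpositions stay 1-based.  Since
   (u * s)%g x = s (u x), left multiplication by a transposition exchanges the
   contents of two positions. *)

Definition transp_at (n j : nat) (s t : 'S_n) : bool :=
  [exists p : 'I_n, exists q : 'I_n,
    [&& p.+1 == j, q.+1 == j.+1 & t == (tperm p q * s)%g]].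

Definition critical (n j : nat) (s t : 'S_n) : bool :=
  transp_at j s t || transp_at (n - j) s t.

Definition simple_allowable (n : nat) (Pi : int -> 'S_n) : Prop :=
  (forall i : int, exists j : nat, transp_at j (Pi i) (Pi (i + 1))) /\
  (forall (i : int) (p : 'I_n), Pi i p = Pi (i + 'C(n, 2)%:Z) (rev_ord p)).

Definition halfperiod_from (n : nat) (Pi : int -> 'S_n) (t : int)
    (i : 'I_('C(n, 2)).+1) : 'S_n := Pi (t + (i : nat)%:Z).

Definition is_halfperiod (n : nat) (Pi : int -> 'S_n)
    (pi : 'I_('C(n, 2)).+1 -> 'S_n) : Prop :=
  exists t : int, forall i, pi i = halfperiod_from Pi t i.

Definition critical_count (n : nat) (pi : 'I_('C(n, 2)).+1 -> 'S_n)
    (j : nat) : nat :=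
  #|[set i : 'I_('C(n, 2)) |
      critical j (pi (widen_ord (leqnSn _) i)) (pi (lift ord0 i))]|.

(* Counted in the halfperiod starting at Pi 0; lemma E_halfperiod below shows
   that every halfperiod gives the same number. *)
Definition E (n : nat) (Pi : int -> 'S_n) (j : nat) : nat :=
  critical_count (halfperiod_from Pi 0) j.+1.

Definition E_ge (n : nat) (Pi : int -> 'S_n) (k : nat) : nat :=
  (\sum_(k <= j < n./2) E Pi j)%N.

Definition center (n k : nat) (s : 'S_n) : {set 'I_n} :=
  [set s p | p : 'I_n & (k <= p < n - k)%N].

(* The default value of the iterated minimum is the term of index 0. *)
Definition min_center (n k : nat) (pi : 'I_('C(n, 2)).+1 -> 'S_n) : nat :=
  \big[minn/#|center k (pi ord0)|]_(i < ('C(n, 2)).+1)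
    #|center k (pi ord0) :&: center k (pi i)|.

Lemma transp_at_rev (n j : nat) (s t s' t' : 'S_n) :
  (forall p, s p = s' (rev_ord p)) -> (forall p, t p = t' (rev_ord p)) ->
  transp_at j s t -> (j < n)%N /\ transp_at (n - j) s' t'.
Proof.
move=> hs ht /existsP[p /existsP[q /and3P[/eqP pj /eqP qj /eqP tE]]].
have jn : (j < n)%N by move: (ltn_ord q); rewrite qj.
split=> //; apply/existsP; exists (rev_ord q); apply/existsP.
exists (rev_ord p); apply/and3P; split.
- by rewrite /= qj subnSK.
- by rewrite /= pj eqxx.
apply/eqP/permP => x; rewrite -[x]rev_ordK -ht tE !permM hs; congr (s' _).
rewrite !permE /= !(can_eq (@rev_ordK n)).
by case: eqVneq => [->|xp]; [case: eqVneq => [->|] | case: eqVneq].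
Qed.

Lemma critical_rev (n j : nat) (s t s' t' : 'S_n) :
  (forall p, s p = s' (rev_ord p)) -> (forall p, t p = t' (rev_ord p)) ->
  critical j s t = critical j s' t'.
Proof.
have main (u v u' v' : 'S_n) : (forall p, u p = u' (rev_ord p)) ->
    (forall p, v p = v' (rev_ord p)) -> critical j u v -> critical j u' v'.
  move=> hu hv /orP[] h; have [jn h'] := transp_at_rev hu hv h.
    by rewrite /critical h' orbT.
  have jn' : (j <= n)%N.
    case: (leqP j n) => // /ltnW; rewrite -subn_eq0 => /eqP j0.
    by case/existsP: h => p /existsP[q]; rewrite j0 => /and3P[].
  by rewrite /critical -{1}(subKn jn') h'.
move=> hs ht; apply/idP/idP; first exact: main.
by apply: main => p; rewrite ?hs ?ht rev_ordK.
Qed.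

Lemma critical_count_from (n : nat) (Pi : int -> 'S_n) (t : int) (j : nat) :
  critical_count (halfperiod_from Pi t) j =
  (\sum_(i < 'C(n, 2))
     critical j (Pi (t + i%:Z)%R) (Pi (t + i%:Z + 1)%R))%N.
Proof.
rewrite /critical_count -sum1dep_card big_mkcond /=; apply: eq_bigr => i _.
rewrite /halfperiod_from /= /bump /= add1n -addrA -[(i : nat).+1]addn1 PoszD.
by case: critical.
Qed.

Lemma E_halfperiod (n : nat) (Pi : int -> 'S_n)
    (pi : 'I_('C(n, 2)).+1 -> 'S_n) (j : nat) :
  simple_allowable Pi -> is_halfperiod Pi pi ->
  critical_count pi j.+1 = E Pi j.
Proof.
move=> [_ hrev] [t ht].
have -> : critical_count pi j.+1 = critical_count (halfperiod_from Pi t) j.+1.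
  by rewrite /critical_count; apply: eq_card => i; rewrite !inE !ht.
suff step u : critical_count (halfperiod_from Pi (u + 1)) j.+1 =
               critical_count (halfperiod_from Pi u) j.+1.
  rewrite /E; elim/int_rec: t {ht} => [//|m <-|m <-].
    by rewrite -addn1 PoszD step.
  by rewrite -[LHS]step -addn1 PoszD opprD addrNK.
rewrite !critical_count_from.
case defN: 'C(n, 2) => [|N]; first by rewrite !big_ord0.
rewrite [LHS]big_ord_recr [RHS]big_ord_recl /= addr0 addnC; congr (_ + _)%N.
  rewrite -[u + 1 + N%:Z]addrA -PoszD add1n -defN addrAC; congr nat_of_bool.
  by apply/esym/critical_rev => p; apply: hrev.
apply: eq_bigr => i _; rewrite /bump /= PoszD addrA //.
Qed.

(* Main.v *)
Require Import Defs.
From mathcomp Require Import all_boot all_order all_fingroup all_algebra.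
From mathcomp Require Import zify lra.

Import Order.TTheory GRing.Theory Num.Theory.
Local Open Scope ring_scope.

Set Implicit Arguments.
Unset Strict Implicit.
Unset Printing Implicit Defensive.

(** Rename the elements by their initial positions, so that the halfperiod
runs from the identity to the order-reversing permutation.  It has as many
steps as there are pairs, and each pair has to be inverted, so every step
exchanges two neighbours that are still in their initial order
([steps_increase]): no pair is ever exchanged twice, and smaller elements only
move to the right of larger ones.

Write M = n - 2k for the width of the center and m for the minimum s(k, pi).
Let c be the number of elements of the initial center that lie in the center
now ([core]).  Two further quantities are followed along the halfperiod.

- Call a pair pending when it is still in its initial order and either both
  elements are in the center now, or both were there initially ([pending]).
  An exchange inside the center uses up a pending pair, and a critical
  exchange creates at most M - 1 of them, by pairing the entering element with
  the rest of the center.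

- Let Z be the number of elements that started to the left or to the right of
  the center and are not on that side now ([away]); Z grows from 0 to 2k.

The M - 1 new pairs are affordable when Z increases.  In the other critical
exchanges, say at the left end of the center, the elements of the initial
center that are present give no net gain.  If the entering element started on
the left, then so did the leaving one, which loses as many pending pairs with
them.  If it started on the right, it is already inverted with them.  If it
started in the center, its pairs with them were pending anyway, and the pair
exchanged is lost if the leaving element started there too.  So pending grows
by at most M - 1 - c when Z does not increase ([pending_tperm_left]; the right
end of the center is the mirror image, see [flip]).

The last bound depends on c, and this pays for the growth of the deficit
(c - m)(c - 1), which grows by 2c - m when c becomes c + 1.  With E for
the number of exchanges inside the center and K for the number of critical
ones, each step therefore satisfies

  2 dE + 2 d(pending) + d(deficit) <= (2M - 2 - m) dK + m dZ,

also with the term d(deficit) omitted ([step_bound]).  Omit it up to a moment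
at which c = m, where the deficit is 0, and keep it from then on until c = M.
Since pending starts at M(M - 1)/2, the final deficit is (M - m)(M - 1) and Z
is at most 2k, the sum is 2E <= (2M - 2 - m)K + m(n - 1)
([halfperiod_bound]), which is the claim. *)

(** * Quantities attached to a permutation *)

Definition mid {n : nat} (k : nat) (p : 'I_n) : bool := (k <= p < n - k)%N.

(** The initial arrangement being the identity, an element belongs to the
initial center exactly when it satisfies [mid]. *)
Definition core {n : nat} (k : nat) (s : 'S_n) : int :=
  \sum_(p : 'I_n) (mid k p && mid k (s p))%:R.

(** Here [x] and [y] are elements, and [u] and [v] the positions they
occupy. *)
Definition linked {n : nat} (k : nat) (x y u v : 'I_n) : bool :=
  mid k x && mid k y || mid k u && mid k v.

Definition pending {n : nat} (k : nat) (s : 'S_n) : int :=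
  \sum_(u : 'I_n) \sum_(v : 'I_n)
     [&& (u < v)%N, (s u < s v)%N & linked k (s u) (s v) u v]%:R.

Definition away {n : nat} (k : nat) (s : 'S_n) : int :=
  \sum_(p : 'I_n) ((k <= p)%N && (s p < k)%N)%:R +
  \sum_(p : 'I_n) ((p < n - k)%N && (n - k <= s p)%N)%:R.

Definition width (n k : nat) : int := \sum_(p : 'I_n) (mid k p)%:R.

(** This is the multiple of c - m, with c the core, that grows by 2c - m when c
becomes c + 1: a critical exchange of that kind may cost 2M - 2 - m, with M the
width, and spends at most 2(M - 1 - c) of it on pending pairs. *)
Definition deficit {n : nat} (k : nat) (m : int) (s : 'S_n) : int :=
  (core k s - m) * (core k s - 1).

(** * The effect of an adjacent transposition *)

(** Both sums are taken over elements, named by the position they occupy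
before the exchange, so that the two arrangements can be compared pair by
pair. *)
Lemma pending_tperm (n k : nat) (p q : 'I_n) (s : 'S_n) :
  pending k (tperm p q * s)%g =
  \sum_(u : 'I_n) \sum_(v : 'I_n)
    [&& (tperm p q u < tperm p q v)%N, (s u < s v)%N &
        linked k (s u) (s v) (tperm p q u) (tperm p q v)]%:R.
Proof.
rewrite /pending (reindex_inj (@perm_inj _ (tperm p q))) /=.
apply: eq_bigr => u _; rewrite (reindex_inj (@perm_inj _ (tperm p q))) /=.
by apply: eq_bigr => v _; rewrite !permM !tpermK.
Qed.

(** No position lies strictly between [p] and [q]. *)
Lemma ltn_tperm_adjacent (n : nat) (p q u v : 'I_n) :
  q = p.+1 :> nat -> u != p -> u != q ->
  ((tperm p q u < tperm p q v) = (u < v))%N /\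
  ((tperm p q v < tperm p q u) = (v < u))%N.
Proof.
move=> qE up uq; rewrite [tperm p q u]tpermD 1?eq_sym // permE /=.
move: up uq; rewrite -!(inj_eq val_inj) /=.
by case: ifP => [/eqP->|_]; last case: ifP => [/eqP->|_]; split; lia.
Qed.

(** When the exchanged positions are both in the center or both outside, no
element changes zone, so only the exchanged pair can become or cease to be
pending.  For k = 0 every pair is linked, and the lemma counts inversions. *)
Lemma pending_tperm_same (n k : nat) (p q : 'I_n) (s : 'S_n) :
  q = p.+1 :> nat -> mid k p = mid k q ->
  pending k (tperm p q * s)%g - pending k s =
  (linked k (s p) (s q) p q)%:R * ((s q < s p)%N%:R - (s p < s q)%N%:R).
Proof.
move=> qE mE; rewrite pending_tperm /pending -sumrB.
have pq : p != q by apply/eqP => pq; move: qE; rewrite pq; lia.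
have midt u : mid k (tperm p q u) = mid k u.
  by rewrite permE /=; case: eqVneq => [->|_] //; case: eqVneq => [->|_].
have termE u v : linked k (s u) (s v) (tperm p q u) (tperm p q v) =
                 linked k (s u) (s v) u v by rewrite /linked !midt.
rewrite (bigD1 p) // (bigD1 q) 1?eq_sym //=
  [X in _ + (_ + X)]big1 ?addr0; last first.
  move=> u /andP[up uq]; rewrite -sumrB big1 // => v _.
  by rewrite termE (ltn_tperm_adjacent v qE up uq).1 subrr.
rewrite -!sumrB -big_split /=.
rewrite (bigD1 p) // (bigD1 q) 1?eq_sym //= big1 ?addr0; last first.
  move=> v /andP[vp vq].
  by rewrite !termE !(ltn_tperm_adjacent _ qE vp vq).2 !subrr.
rewrite !termE !tpermL !tpermR !ltnn qE ltnSn (ltnNge p.+1) leqnSn /=.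
have -> : linked k (s q) (s p) q p = linked k (s p) (s q) p q.
  by rewrite /linked andbC [mid k q && _]andbC.
by case: linked; case: (s p < s q)%N; case: (s q < s p)%N.
Qed.

(** The element [s p] enters the center from the left and [s q] leaves it.
Against each remaining position v of the center, the entering element gains at
most one pending pair.  If [s q] also started on the left, or [s p] on the
right, the elements of the initial center found there are no gain: they form
pending pairs with the leaving element, which are lost, in the former case,
and they are already inverted with the entering one in the latter.  If [s p]
belongs to the initial center, these pairs are pending already; when [s q]
belongs to it too, the pair exchanged makes up for the term of [s q] in the
core. *)
Lemma pending_tperm_left (n k : nat) (p q : 'I_n) (s : 'S_n) :
  (2 * k < n)%N -> q = p.+1 :> nat -> q = k :> nat -> (s p < s q)%N ->
  pending k (tperm p q * s)%g - pending k s <=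
  width n k - 1 - (if (s p < k <= s q)%N then 0 else core k s).
Proof.
move=> kn qE qk spq; rewrite pending_tperm /pending -sumrB.
have pq : p != q by apply/eqP => pq; move: qE; rewrite pq; lia.
rewrite (bigD1 p) // (bigD1 q) 1?eq_sym //=
  [X in _ + (_ + X)]big1 ?addr0; last first.
  move=> u /andP[up uq]; rewrite -sumrB big1 // => v _.
  rewrite (ltn_tperm_adjacent v qE up uq).1 [tperm p q u]tpermD 1?eq_sym //.
  rewrite /linked permE /=; move: up uq.
  rewrite -!(inj_eq val_inj) /= /mid => up uq.
  by case: ifP => [/eqP vE|_]; last case: ifP => [/eqP vE|_];
    rewrite ?subrr //; lia.
rewrite -!sumrB -big_split /=.
pose c := (s p < k <= s q)%N.
(* The term of q accounts for the exchanged pair, the term of any other v for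
   the pairs that s p and s q form with the element at v. *)
have -> : width n k - 1 - (if c then 0 else core k s) =
    \sum_(v : 'I_n) ((mid k v)%:R - (v == q)%:R -
                     (~~ c && (mid k v && mid k (s v)))%:R).
  rewrite !sumrB; congr (_ - _ - _).
    by rewrite (bigD1 q) //= eqxx big1 ?addr0 // => v /negbTE->.
  by rewrite /core; case: (c) => //=; rewrite big1.
apply: ler_sum => v _; rewrite tpermL tpermR.
have [->|vp] := eqVneq v p.
  by rewrite tpermL (negbTE pq) /linked /c /mid; lia.
have [->|vq] := eqVneq v q.
  by rewrite tpermR /linked /c /mid; move: (ltn_ord (s q)); lia.
rewrite tpermD 1?eq_sym //.
have mp : mid k p = false by rewrite /mid; lia.
have mq : mid k q by rewrite /mid; lia.
have -> : (p < v)%N = (q < v)%N.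
  by move: vp vq; rewrite -!(inj_eq val_inj) /=; lia.
have [qv|vq'] := ltnP q v; last first.
  by rewrite /mid; move: vq; rewrite -!(inj_eq val_inj) /=; lia.
rewrite /linked mp mq /= orbF.
case: (mid k v); last by rewrite !orbF !subrr andbF.
rewrite orbT !andbT.
move: (ltn_ord (s p)) (ltn_ord (s q)) (ltn_ord (s v)).
rewrite /c /mid.
move: {c} (nat_of_ord (s p)) (nat_of_ord (s q)) (nat_of_ord (s v)) spq.
move=> x y z xy xn yn zn.
lia.
Qed.

Lemma sum_tperm (n : nat) (p q : 'I_n) (s : 'S_n) (f g : pred 'I_n) :
  \sum_u (f u && g ((tperm p q * s)%g u))%:R - \sum_u (f u && g (s u))%:R =
  ((f q)%:R - (f p)%:R) * ((g (s p))%:R - (g (s q))%:R) :> int.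
Proof.
rewrite (reindex_inj (@perm_inj _ (tperm p q))) /= -sumrB.
have [->|qp] := eqVneq q p.
  by rewrite subrr mul0r big1 // => u _; rewrite tperm1 permM !perm1 subrr.
rewrite (bigD1 p) // (bigD1 q) //= big1 ?addr0; last first.
  by move=> u /andP[up uq]; rewrite permM tpermK [tperm p q u]tpermD 1?eq_sym
    ?subrr.
rewrite !permM !tpermK tpermL tpermR.
by case: (f p) (f q) (g (s p)) (g (s q)) => [] [] [] [].
Qed.

Lemma core_tperm (n k : nat) (p q : 'I_n) (s : 'S_n) :
  core k (tperm p q * s)%g - core k s =
  ((mid k q)%:R - (mid k p)%:R) * ((mid k (s p))%:R - (mid k (s q))%:R).
Proof. exact: sum_tperm. Qed.

Lemma away_tperm (n k : nat) (p q : 'I_n) (s : 'S_n) :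
  away k (tperm p q * s)%g - away k s =
  ((k <= q)%N%:R - (k <= p)%N%:R) * ((s p < k)%N%:R - (s q < k)%N%:R) +
  ((q < n - k)%N%:R - (p < n - k)%N%:R) *
     ((n - k <= s p)%N%:R - (n - k <= s q)%N%:R).
Proof.
rewrite /away opprD addrACA; congr (_ + _).
  exact: (sum_tperm p q s (fun u : 'I_n => k <= u)%N (fun u : 'I_n => u < k)%N).
exact: (sum_tperm p q s (fun u : 'I_n => u < n - k)%N
          (fun u : 'I_n => n - k <= u)%N).
Qed.

(** The deficit grows only when an element of the initial center replaces one
that started on the right.  Then [pending] grows by at most M - 1 - c, which
leaves 2c - m of the allowance 2M - 2 - m, exactly the growth of the
deficit.  When Z increases, the term m on the right makes room for M - 1 new
pending pairs. *)
Lemma step_left (n k : nat) (p q : 'I_n) (s : 'S_n) (m : int) (f : bool) :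
  (2 * k < n)%N -> q = p.+1 :> nat -> q = k :> nat -> (s p < s q)%N ->
  0 <= m -> m <= core k s -> m <= core k (tperm p q * s)%g ->
  2 * (pending k (tperm p q * s)%g - pending k s)
    + f%:R * (deficit k m (tperm p q * s)%g - deficit k m s)
  <= 2 * width n k - 2 - m + m * (away k (tperm p q * s)%g - away k s).
Proof.
move=> kn qE qk spq m0 ms mt.
have := pending_tperm_left kn qE qk spq.
have := core_tperm k p q s; have := away_tperm k p q s.
have -> : mid k p = false by rewrite /mid; lia.
have -> : mid k q by rewrite /mid; lia.
have -> : (k <= p)%N = false by lia.
have -> : (k <= q)%N by lia.
have -> : (p < n - k)%N by lia.
have -> : (q < n - k)%N by lia.
rewrite /deficit; move: (tperm p q * s)%g mt => t.
move: (pending k t) (pending k s) (away k t) (away k s) (width n k) ms.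
move: (core k t) (core k s) => ct c Pt P zt z w ms mt.
rewrite /= !mulr0n !mulr1n subrr !subr0 mul0r addr0 !mul1r.
move=> -> /(canRL (subrK _)) cE.
move: mt; rewrite {}cE /mid.
have [ak|ak] := ltnP (s p) k; have [bk|bk] := ltnP (s q) k;
have [ak'|ak'] := ltnP (s p) (n - k)%N; have [bk'|bk'] := ltnP (s q) (n - k)%N;
  rewrite /= => mt EP; try (exfalso; clear -ak bk ak' bk' spq kn; lia);
  by case: f; clear ak bk ak' bk'; nia.
Qed.

(** * Left-right symmetry *)

(** Reversing both the positions and the elements keeps the initial order of
a pair, and turns an exchange at the right end of the center into one at its
left end. *)
Definition flip {n : nat} (s : 'S_n) : 'S_n :=
  (perm (@rev_ord_inj n) * s * perm (@rev_ord_inj n))%g.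

Lemma flipE (n : nat) (s : 'S_n) (u : 'I_n) :
  flip s u = rev_ord (s (rev_ord u)).
Proof. by rewrite !permM !permE. Qed.

Lemma flip_tperm (n : nat) (p q : 'I_n) (s : 'S_n) :
  flip (tperm p q * s)%g = (tperm (rev_ord q) (rev_ord p) * flip s)%g.
Proof.
apply/permP => u.
rewrite [RHS]permM !flipE (permM (tperm p q)); congr (rev_ord (s _)).
rewrite -{1}(rev_ordK p) -{1}(rev_ordK q) tpermC.
rewrite !permE /= !(inj_eq rev_ord_inj).
by do 2!case: ifP => _ //; rewrite rev_ordK.
Qed.

Lemma mid_rev (n k : nat) (u : 'I_n) : mid k (rev_ord u) = mid k u.
Proof. by rewrite /mid /=; have := ltn_ord u; lia. Qed.

Lemma core_flip (n k : nat) (s : 'S_n) : core k (flip s) = core k s.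
Proof.
rewrite /core (reindex_inj (@rev_ord_inj n)); apply: eq_bigr => u _.
by rewrite flipE rev_ordK !mid_rev.
Qed.

Lemma away_flip (n k : nat) (s : 'S_n) : away k (flip s) = away k s.
Proof.
rewrite /away addrC; congr (_ + _);
  rewrite (reindex_inj (@rev_ord_inj n)); apply: eq_bigr => u _;
  rewrite flipE rev_ordK /=; have := ltn_ord u; have := ltn_ord (s u); lia.
Qed.

Lemma pending_flip (n k : nat) (s : 'S_n) : pending k (flip s) = pending k s.
Proof.
rewrite /pending exchange_big (reindex_inj (@rev_ord_inj n)) /=.
apply: eq_bigr => u _; rewrite (reindex_inj (@rev_ord_inj n)) /=.
apply: eq_bigr => v _; rewrite !flipE !rev_ordK /linked !mid_rev.
rewrite [mid k (s v) && _]andbC [mid k v && _]andbC.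
have revE (x y : 'I_n) : (rev_ord x < rev_ord y)%N = (y < x)%N.
  by rewrite /=; have := ltn_ord x; have := ltn_ord y; lia.
by rewrite !revE.
Qed.

(** * The inequality of one step and its sum *)

(** The flag [f] switches the deficit on or off; both versions are needed
because the deficit is only to be followed from the minimum of the core
onwards. *)
Lemma step_bound (n k : nat) (p q : 'I_n) (s : 'S_n) (m : int) (f : bool) :
  (2 * k < n)%N -> q = p.+1 :> nat -> (s p < s q)%N ->
  0 <= m -> m <= core k s -> m <= core k (tperm p q * s)%g ->
  2 * (mid k p && mid k q)%:R + 2 * (pending k (tperm p q * s)%g - pending k s)
    + f%:R * (deficit k m (tperm p q * s)%g - deficit k m s)
  <= (2 * width n k - 2 - m) * (mid k p != mid k q)%:R
    + m * (away k (tperm p q * s)%g - away k s).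
Proof.
move=> kn qE spq m0 ms mt.
have [mE|mN] := eqVneq (mid k p) (mid k q).
  have cE := core_tperm k p q s; rewrite mE subrr mul0r in cE.
  rewrite /deficit (subr0_eq cE) subrr mulr0 addr0.
  rewrite (pending_tperm_same s qE mE) ltnNge (ltnW spq) spq away_tperm.
  have -> : (k <= q)%N = (k <= p)%N.
    by move: mE; rewrite /mid; have := ltn_ord q; lia.
  have -> : (q < n - k)%N = (p < n - k)%N.
    by move: mE; rewrite /mid; have := ltn_ord q; lia.
  rewrite !subrr !mul0r mulr0 /= mE andbb /linked mE andbb.
  by case: (mid k q); rewrite ?orbT //; lia.
have -> : (mid k p && mid k q) = false by move: mN; do 2!case: mid.
rewrite mulr0 add0r mulr1.
(* The exchange is at the left end of the center if q = k, and at its right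
   end otherwise. *)
have [qk|qk] := eqVneq (q : nat) k; first exact: step_left.
have {}qk : q = (n - k)%N :> nat by move: mN; rewrite /mid; lia.
have := @step_left n k (rev_ord q) (rev_ord p) (flip s) m f kn.
rewrite -flip_tperm /deficit !core_flip !away_flip !pending_flip; apply => //=.
- by have := ltn_ord q; lia.
- by lia.
by rewrite !flipE !rev_ordK /=; have := ltn_ord (s q); lia.
Qed.

Lemma sum_interval (n a b : nat) : (a <= b <= n)%N ->
  \sum_(p : 'I_n) (a <= p < b)%N%:R = b%:Z - a%:Z.
Proof.
move=> /andP[ab bn].
rewrite -(big_mkord xpredT (fun i => (a <= i < b)%N%:R)).
rewrite (big_cat_nat (n := b)) //= (big_cat_nat (n := a)) //=.
rewrite [X in X + _ + _]big1_seq; last first.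
  by move=> i; rewrite mem_index_iota => /= ia; rewrite leqNgt ia.
rewrite [X in _ + X]big1_seq; last first.
  move=> i; rewrite mem_index_iota => /andP[_ /andP[bi _]].
  by rewrite (ltnNge i) bi andbF.
rewrite add0r addr0 (eq_big_seq (fun=> 1)); last first.
  by move=> i; rewrite mem_index_iota => ->.
by rewrite big_const_nat iter_addr_0; lia.
Qed.

Lemma widthE (n k : nat) : (2 * k < n)%N -> width n k = n%:Z - 2 * k%:Z.
Proof. by move=> kn; rewrite /width sum_interval; lia. Qed.

(** Each of the two sums in [away] counts elements that started on one given
side, and each side has k positions. *)
Lemma away_le (n k : nat) (s : 'S_n) : (2 * k < n)%N -> away k s <= 2 * k%:Z.
Proof.
move=> kn; have -> : 2 * k%:Z = (k%:Z - 0%:Z) + (n%:Z - (n - k)%N%:Z) by lia.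
rewrite -!(@sum_interval n); try lia.
rewrite [X in _ <= X + _](reindex_inj (@perm_inj _ s)).
rewrite [X in _ <= _ + X](reindex_inj (@perm_inj _ s)).
apply: lerD; apply: ler_sum => u _; last by have := ltn_ord (s u); lia.
by lia.
Qed.

Lemma away1 (n k : nat) : away k (1 : 'S_n)%g = 0.
Proof. by rewrite /away !big1 // => u _; rewrite perm1; lia. Qed.

Lemma pending1 (n k : nat) :
  2 * pending k (1 : 'S_n)%g = width n k * (width n k - 1).
Proof.
have -> : pending k (1 : 'S_n)%g =
    \sum_(u : 'I_n) \sum_(v : 'I_n) ((u < v)%N && (mid k u && mid k v))%:R.
  apply: eq_bigr => u _; apply: eq_bigr => v _.
  by rewrite !perm1 /linked orbb; case: ltnP.
rewrite mulr2n mulrDl mul1r {2}exchange_big mulrBr mulr1.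
apply/(canRL (addrK _)).
rewrite /width mulr_suml -!big_split /=; apply: eq_bigr => u _.
rewrite mulr_sumr -!big_split /=.
have {1}-> : (mid k u)%:R = \sum_(v : 'I_n) ((v == u) && mid k u)%:R :> int.
  by rewrite (bigD1 u) //= eqxx big1 ?addr0 // => v /negbTE->.
rewrite -big_split; apply: eq_bigr => v _.
rewrite -(inj_eq val_inj) /=; case: (ltngtP u v) => [||/val_inj->];
  by case: (mid k u) (mid k v) => [] [].
Qed.

(** For k = 0 the pending pairs are the pairs that are not inverted.  A step
lowers their number by at most one, and it has to fall from binomial(n, 2) to
0 in binomial(n, 2) steps; so every step has to lower it. *)
Lemma steps_increase (n : nat) (r : nat -> 'S_n) (p q : nat -> 'I_n) :
  r 0%N = 1%g -> (forall u, r 'C(n, 2) u = rev_ord u) ->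
  (forall i, q i = (p i).+1 :> nat) ->
  (forall i, r i.+1 = (tperm (p i) (q i) * r i)%g) ->
  forall i, (i < 'C(n, 2))%N -> (r i (p i) < r i (q i))%N.
Proof.
move=> r0 rN qE rS i iN; rewrite ltnNge; apply/negP => bad.
have mid0 (u : 'I_n) : mid 0 u by rewrite /mid /=; have := ltn_ord u; lia.
have all_linked (x y u v : 'I_n) : linked 0 x y u v by rewrite /linked !mid0.
have step j : pending 0 (r j.+1) - pending 0 (r j) =
    (r j (q j) < r j (p j))%N%:R - (r j (p j) < r j (q j))%N%:R.
  by rewrite rS pending_tperm_same ?qE ?mid0 // all_linked mul1r.
(* From a step i that creates a pending pair onwards, the count lags behind
   the greatest possible decrease. *)
have slow j : pending 0 (1 : 'S_n)%g + (i < j)%N%:R <= pending 0 (r j) + j%:Z.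
  elim: j => [|j IH]; first by rewrite r0; lia.
  have := step j; move: IH; case: (eqVneq i j) => [<-|ij].
    have : r i (p i) != r i (q i) :> nat.
      rewrite (inj_eq val_inj) (inj_eq perm_inj) -(inj_eq val_inj) /= qE.
      by lia.
    by move: bad; case: (ltngtP (r i (p i)) (r i (q i))); lia.
  by lia.
have end0 : pending 0 (r 'C(n, 2)) = 0.
  rewrite /pending big1 // => u _; rewrite big1 // => v _.
  rewrite !rN all_linked /= andbT; case: (ltnP u v) => //= uv.
  by rewrite ltnNge leq_sub2l // ltnW.
have n_gt0 : (0 < n)%N by apply: leq_ltn_trans (leq0n _) (ltn_ord (p i)).
have := slow 'C(n, 2); have := pending1 n 0; have := mul_bin_diag n 1.
rewrite end0 iN bin1 widthE //; nia.
Qed.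

(** The inequalities of the steps are added, with the deficit switched on
after the moment j at which the core attains its minimum. *)
Lemma halfperiod_bound (n k N : nat) (r : nat -> 'S_n) (p q : nat -> 'I_n)
    (m : int) (j : nat) :
  (2 * k < n)%N -> 0 <= m -> (forall i, (i <= N)%N -> m <= core k (r i)) ->
  (j <= N)%N -> core k (r j) = m ->
  r 0%N = 1%g -> core k (r N) = width n k ->
  (forall i, q i = (p i).+1 :> nat) ->
  (forall i, r i.+1 = (tperm (p i) (q i) * r i)%g) ->
  (forall i, (i < N)%N -> (r i (p i) < r i (q i))%N) ->
  2 * \sum_(i < N) (mid k (p i) && mid k (q i))%:R <=
  (2 * width n k - 2 - m) * \sum_(i < N) (mid k (p i) != mid k (q i))%:R
    + m * (n%:Z - 1).
Proof.
move=> kn m0 mr jN rj r0 rN qE rS inc.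
have acc i : (i <= N)%N ->
    2 * \sum_(l < i) (mid k (p l) && mid k (q l))%:R + 2 * pending k (r i)
      + (j <= i)%N%:R * deficit k m (r i)
    <= width n k * (width n k - 1)
      + (2 * width n k - 2 - m) * \sum_(l < i) (mid k (p l) != mid k (q l))%:R
      + m * away k (r i).
  elim: i => [|i IH] iN.
    rewrite !big_ord0 r0 away1 pending1 !mulr0 add0r !addr0.
    rewrite leqn0; case: eqVneq => [j0|_]; last by rewrite mul0r addr0.
    have m1 : core k (1 : 'S_n)%g = m by rewrite -r0 -rj j0.
    by rewrite /deficit m1 subrr mul0r mulr0 addr0.
  have := step_bound (j <= i)%N kn (qE i) (inc i iN) m0 (mr _ (ltnW iN)).
  rewrite -rS => /(_ (mr _ iN)) st; have {}IH := IH (ltnW iN).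
  rewrite !big_ord_recr /=.
  (* The deficit is switched on at time j without a jump, as it vanishes
     then. *)
  have -> : (j <= i.+1)%N%:R * deficit k m (r i.+1) =
            (j <= i)%N%:R * deficit k m (r i.+1).
    have [ji|ji] := eqVneq j i.+1; last first.
      by congr ((nat_of_bool _)%:R * _); lia.
    by rewrite /deficit -ji rj subrr mul0r !mulr0.
  lra.
have pN : 0 <= pending k (r N).
  by apply: sumr_ge0 => u _; apply: sumr_ge0 => v _; case: (X in X%:R).
have := acc N (leqnn N); rewrite jN mul1r /deficit rN => {acc} top.
have := ler_wpM2l m0 (away_le (r N) kn); have := widthE kn => wE.
have -> : n%:Z = width n k + 2 * k%:Z by lia.
by move: top; lra.
Qed.

(** * Critical transpositions and the minimal core *)

Lemma transp_at_tperm (n j : nat) (p q : 'I_n) (s : 'S_n) :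
  q = p.+1 :> nat -> transp_at j s (tperm p q * s)%g = (j == p.+1).
Proof.
move=> qE; apply/existsP/eqP => [[p' /existsP[q']]|->]; last first.
  by exists p; apply/existsP; exists q; rewrite qE !eqxx.
case/and3P=> /eqP p'E /eqP q'E /eqP /mulIg tE; rewrite -p'E.
have := congr1 (fun u : 'S_n => nat_of_ord (u p)) tE.
rewrite tpermL qE permE /=; case: eqVneq => [->//|_].
by case: eqVneq => [pq'|_]; rewrite ?pq'; lia.
Qed.

Lemma critical_tperm (n k : nat) (p q : 'I_n) (s : 'S_n) :
  (0 < k)%N -> (2 * k < n)%N -> q = p.+1 :> nat ->
  critical k s (tperm p q * s)%g = (mid k p != mid k q).
Proof.
move=> k0 kn qE; rewrite /critical !transp_at_tperm // /mid.
by have := ltn_ord q; lia.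
Qed.

(** The exchange is j-critical for exactly one j up to n/2, namely its distance
to the nearer end; summing over the j larger than k tests whether both
positions lie in the center. *)
Lemma sum_critical_tperm (n k : nat) (p q : 'I_n) (s : 'S_n) :
  q = p.+1 :> nat ->
  (\sum_(k <= j < n./2) critical j.+1 s (tperm p q * s)%g)%N =
  (mid k p && mid k q) :> nat.
Proof.
move=> qE; have qn := ltn_ord q.
pose j0 := minn p (n - q.+1).
rewrite (eq_big_nat _ _ (F2 := fun j => (j == j0) : nat)); last first.
  move=> j /andP[_ jn]; congr nat_of_bool.
  by rewrite /critical !transp_at_tperm // /j0; lia.
rewrite -big_mkcond sum1_count count_uniq_mem ?iota_uniq // mem_index_iota.
by congr nat_of_bool; rewrite /mid /j0; lia.
Qed.

Lemma min_center_le (n k : nat) (pi : 'I_('C(n, 2)).+1 -> 'S_n)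
    (i : 'I_('C(n, 2)).+1) :
  (min_center k pi <= #|center k (pi ord0) :&: center k (pi i)|)%N.
Proof.
rewrite /min_center; have := mem_index_enum i.
elim: (index_enum _) => // l e IH; rewrite inE big_cons geq_min.
by case/predU1P => [->|/IH->]; rewrite ?leqnn ?orbT.
Qed.

Lemma min_center_attained (n k : nat) (pi : 'I_('C(n, 2)).+1 -> 'S_n) :
  exists i, min_center k pi = #|center k (pi ord0) :&: center k (pi i)|.
Proof.
rewrite /min_center; apply: (big_ind (fun m : nat => exists i, m = _)).
- by exists ord0; rewrite setIid.
- by move=> x y ? ?; rewrite /minn; case: ifP.
by move=> i _; exists i.
Qed.

(** The permutation on the right is [t] with the elements renamed by their
positions in [s]. *)
Lemma card_centerI (n k : nat) (s t : 'S_n) :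
  #|center k s :&: center k t|%:Z = core k (t * s^-1)%g.
Proof.
have -> : center k s :&: center k t =
    t @: [set p | mid k p && mid k ((t * s^-1)%g p)].
  apply/setP => x; rewrite inE andbC; apply/andP/imsetP => [[]|[p]].
    move=> /imsetP[p /[!inE] kp ->] /imsetP[u /[!inE] ku tE].
    by exists p; rewrite // inE permM tE permK; apply/andP.
  rewrite inE permM => /andP[kp ku] ->; split.
    by apply: imset_f; rewrite inE.
  by apply/imsetP; exists (s^-1 (t p))%g; rewrite ?inE ?permKV.
rewrite card_imset; last exact: perm_inj.
rewrite -sum1dep_card big_mkcond -natz natr_sum /=.
by apply: eq_bigr => p _; case: (_ && _).
Qed.

(** * The bound on E_(>= k) *)

Theorem theorem1 (n k : nat) (Pi : int -> 'S_n)
    (pi : 'I_('C(n, 2)).+1 -> 'S_n) (s : nat)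
    (hk : (1 <= k)%N) (hkn : (2 * k < n)%N)
    (hPi : simple_allowable Pi) (hpi : is_halfperiod Pi pi)
    (hs : s = min_center k pi) :
  ((E_ge Pi k)%:R : rat) <=
    (n%:R - 2 * k%:R - 1) * (E Pi (k - 1))%:R
    - s%:R / 2 * ((E Pi (k - 1))%:R - n%:R + 1).
Proof.
have [t piE] := hpi; have [adj rev] := hPi.
pose P (i : nat) := Pi (t + i%:Z).
have PS i : P i.+1 = Pi (t + i%:Z + 1) by rewrite /P -addn1 PoszD addrA.
have ex i : exists pq : 'I_n * 'I_n, (pq.2 == pq.1.+1 :> nat) &&
    (P i.+1 == tperm pq.1 pq.2 * P i)%g.
  have [j /existsP[p /existsP[q /and3P[/eqP pE /eqP qE PE]]]] := adj (t + i%:Z).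
  by exists (p, q); rewrite PS PE andbT -eqSS qE pE.
pose pq i := sval (sigW (ex i)); pose p i := (pq i).1; pose q i := (pq i).2.
have qE i : q i = (p i).+1 :> nat by case/andP: (svalP (sigW (ex i))) => /eqP.
have PE i : P i.+1 = (tperm (p i) (q i) * P i)%g.
  by case/andP: (svalP (sigW (ex i))) => _ /eqP.
pose N := 'C(n, 2); pose r i := (P i * (P 0%N)^-1)%g.
have r0 : r 0%N = 1%g by rewrite /r mulgV.
have rS i : r i.+1 = (tperm (p i) (q i) * r i)%g by rewrite /r PE mulgA.
have rN u : r N u = rev_ord u.
  rewrite permM -{1}(rev_ordK u) /P -/N.
  by rewrite -[t]addr0 -(addrA t) add0r -rev addr0 permK.
have countE j : E Pi j =
    (\sum_(i < N) critical j.+1 (P i) (tperm (p i) (q i) * P i)%g)%N.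
  have hp : is_halfperiod Pi (halfperiod_from Pi t) by exists t.
  rewrite -(E_halfperiod j hPi hp) critical_count_from.
  by apply: eq_bigr => i _; rewrite -PE PS.
have coreE (i : 'I_N.+1) :
    #|center k (pi ord0) :&: center k (pi i)|%:Z = core k (r i).
  by rewrite card_centerI !piE.
have [j sE] := min_center_attained k pi; rewrite -hs in sE.
have := @halfperiod_bound n k N r p q s%:Z j hkn isT.
rewrite sE coreE => /(_ _ _ erefl r0 _ qE rS (steps_increase r0 rN qE rS)).
have -> : \sum_(i < N) (mid k (p i) && mid k (q i))%:R = (E_ge Pi k)%:Z.
  rewrite /E_ge (eq_bigr _ (fun j _ => countE j)) exchange_big /=.
  rewrite -natz natr_sum; apply: eq_bigr => i _.
  by rewrite sum_critical_tperm.
have -> : \sum_(i < N) (mid k (p i) != mid k (q i))%:R = (E Pi (k - 1))%:Z.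
  rewrite countE subn1 prednK // -natz natr_sum; apply: eq_bigr => i _.
  by rewrite critical_tperm.
rewrite -coreE -sE widthE // => bound.
have {bound} : 2 * (E_ge Pi k)%:Z <=
    (2 * (n%:Z - 2 * k%:Z) - 2 - s%:Z) * (E Pi (k - 1))%:Z + s%:Z * (n%:Z - 1).
  apply: bound => [i iN||].
  - by rewrite -[i]/(nat_of_ord (Ordinal (iN : i < N.+1)%N)) -coreE hs lez_nat
       min_center_le.
  - by rewrite -ltnS.
  rewrite -(widthE hkn); apply: eq_bigr => u _.
  by rewrite rN mid_rev andbb.
rewrite -(ler_int rat) !(rmorphD, rmorphM, rmorphN, rmorph1) /= => bound.
by move: bound; rewrite -!pmulrn; lra.
Qed.
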